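(* Let $B \ge 2$ be an integer base, let $k \ge 1$, and let $N_k = [a_1a_2\dots a_k\, b\, c_1c_2\dots c_k]$ (in base $B$, with $a_1 \neq 0$) have property $P^*_k$. Then the digits satisfy all of the following constraints. (1) $a_1 < B/2$. (2) $b = c_1 = c_2 = \dots = c_{k-1} > c_k > 1$ (that is, $c_i = b$ for all $1 \le i \le k-1$, and $b > c_k > 1$). (3) $\gcd(c_k, B) > 1$. (4) $\gcd(a_k - b, B) > 1$ if $a_k \neq b$.
   Context: Fix an integer base $B \ge 2$. A digit is an integer $x$ with $0 \le x < B$, and for digits $x_1,\dots,x_m$ write $[x_1x_2\dots x_m] = \sum_{i=1}^m x_i B^{m-i}$. For $k \ge 1$ consider a number $N_k = [a_1\dots a_k\, b\, c_1\dots c_k]$ with digits $a_i, b, c_i$ and $a_1 \neq 0$, and put $a = [a_1\dots a_k]$, $c = [c_1\dots c_k]$. $N_k$ has property $P_k$ if $[a_1\dots a_k\, b]\cdot[c_1\dots c_k] = [a_1\dots a_k]\cdot[b\, c_1\dots c_k]$, equivalently $(aB+b)c = a(bB^k + c)$. $N_k$ has property $P^*_k$ if it has property $P_k$, no two of $a, b, c$ are $0$, and the digits $a_1,\dots,a_k,b,c_1,\dots,c_k$ are not all equal. *)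

(* Defs.v *)
From mathcomp Require Import all_boot all_order all_algebra.

Set Implicit Arguments.
Unset Strict Implicit.
Unset Printing Implicit Defensive.

Definition is_digit (B x : nat) : bool := x < B.

(* Digit strings are indexed from 1, most significant digit first:
   [digit s i] is meaningful for 1 <= i <= size s. *)
Definition digit (s : seq nat) (i : nat) : nat := nth 0 s i.-1.

Definition numeral (B : nat) (s : seq nat) : nat :=
  \sum_(1 <= i < (size s).+1) digit s i * B ^ (size s - i).

(* The number [a_1 ... a_k b c_1 ... c_k] is represented by its digits a, b, c. *)
Definition is_N (B k : nat) (a : k.-tuple nat) (b : nat) (c : k.-tuple nat) : Prop :=
  all (is_digit B) (a ++ b :: c) /\ digit a 1 <> 0.

Definition propP (B k : nat) (a : k.-tuple nat) (b : nat) (c : k.-tuple nat) : Prop :=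
  numeral B (rcons a b) * numeral B c = numeral B a * numeral B (b :: c).

Definition propPstar (B k : nat) (a : k.-tuple nat) (b : nat) (c : k.-tuple nat) : Prop :=
  [/\ propP B a b c,
      [/\ ~ (numeral B a = 0 /\ b = 0),
          ~ (numeral B a = 0 /\ numeral B c = 0)
        & ~ (b = 0 /\ numeral B c = 0)]
    & ~ constant (a ++ b :: c)].

(* Main.v *)
Require Import Defs.
From mathcomp Require Import all_boot all_order all_algebra.
From mathcomp Require Import zify ring.

(** Write [A], [C] for the values of the two blocks of digits, [q] for [B - 1],
    and let [R = [bb...b]] be the repdigit of length [k], so that
    [R q + b = b B^k].  Replacing [b B^k] in the product identity gives
    [A q (R - C) = b (C - A)].  Since [b <= q], the case [C > R] is impossible,
    and [C = R] forces [A = R], that is, all digits equal.  Hence [C = R - d]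
    with [d > 0], and the identity takes the form

      [A D = b C]   with   [D = q d + b]      ([two_block_eq]).

    The four constraints all follow from this equation.
    - As [D >= 2 b], we get [2 A <= C < B^k] ([twice_le]), which bounds the
      first digit.
    - As [A >= B^(k-1)] and [C < B^k], we get [D < b B], hence [d < b]
      ([defect_lt]); thus subtracting [d] from [R] affects the last digit
      only, and [C = [b...b(b-d)]].
    - Let [e = b - d] be that digit; then [D = B d + e].  Multiplying
      by [q] and adding [b D] turns the equation into [D (A q + b) = b^2 B^k].
      If [e] were coprime to [B], so would be [D], and [B^k] would
      divide [A q + b], hence also [(R - A) q], hence [R - A], although
      [0 < R - A < B^k].  So [gcd (e, B) > 1]
      ([not_coprime_last]), and in particular [e > 1].
    - Modulo [B] the equation reads [a_k e = b e].  If [a_k - b] were coprime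
      to [B], then [B] would divide [e], although [0 < e < B]
      ([not_coprime_diff]). *)

Lemma numeral_cons B x s : numeral B (x :: s) = x * B ^ size s + numeral B s.
Proof.
rewrite /numeral big_nat_recl //= subSS subn0; congr (_ + _).
by apply: eq_big_nat => -[|i].
Qed.

Lemma numeral_nil B : numeral B [::] = 0.
Proof. by rewrite /numeral big_geq. Qed.

Lemma numeral_rcons B s x : numeral B (rcons s x) = numeral B s * B + x.
Proof.
elim: s => [|y s IH]; first by rewrite numeral_cons numeral_nil muln1 addnC.
by rewrite rcons_cons !numeral_cons IH size_rcons expnS; ring.
Qed.

Lemma numeral_lt B s : 0 < B -> all (is_digit B) s -> numeral B s < B ^ size s.
Proof.
move=> B_gt0; elim: s => [|x s IH] /=; first by rewrite numeral_nil.
case/andP; rewrite /is_digit numeral_cons expnS => ltxB /IH ltsB.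
have : x.+1 * B ^ size s <= B * B ^ size s by rewrite leq_mul2r ltxB orbT.
by rewrite mulSn; lia.
Qed.

Lemma numeral_inj B s t : all (is_digit B) s -> all (is_digit B) t ->
  size s = size t -> numeral B s = numeral B t -> s = t.
Proof.
elim/last_ind: s t => [|s x IH] t; first by case: t.
case/lastP: t => [|t y]; first by rewrite size_rcons.
rewrite !all_rcons !size_rcons !numeral_rcons /is_digit.
move=> /andP[ltxB digs] /andP[ltyB digt] [eq_sz] eq_num.
have eqxy : x = y.
  by move/(congr1 (modn^~ B)): eq_num; rewrite /= !modnMDl !modn_small.
have B_gt0 : 0 < B by lia.
move: eq_num; rewrite eqxy => /addIn /eqP; rewrite eqn_pmul2r // => /eqP eq_num.
by rewrite (IH t).
Qed.

(** The repdigit is [b (B^k - 1) / (B - 1)], without division or subtraction;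
    the base is [q + 1]. *)
Lemma numeral_repdigit q k b :
  numeral q.+1 (nseq k b) * q + b = b * q.+1 ^ k.
Proof.
elim: k => [|k IH]; first by rewrite numeral_nil muln1.
by rewrite numeral_cons size_nseq mulnDl -addnA IH expnS; ring.
Qed.

Lemma digit_size s x : digit (rcons s x) (size s).+1 = x.
Proof. by rewrite /digit nth_rcons ltnn eqxx. Qed.

(** With [E = B^k], [R] is the repdigit.  The case [C > R] does not occur: it
    would give [A q (C - R) < A b], against [b <= q]. *)
Lemma two_block_eq q b E A C R : b <= q -> 0 < b -> 0 < C ->
    R * q + b = b * E ->
    (A * q.+1 + b) * C = A * (b * E + C) ->
  (C = R /\ A = R) \/
  (exists2 d, 0 < d & R = C + d /\ A * (q * d + b) = b * C).
Proof.
move=> leb b_gt0 C_gt0 <- prodE.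
have {}prodE : A * q * C + b * C = A * q * R + A * b.
  apply: (@addnI (A * C)); transitivity ((A * q.+1 + b) * C); first by ring.
  by rewrite prodE; ring.
case: (leqP R C) => [leRC | ltCR]; [left | right]; last first.
  exists (R - C); rewrite ?subn_gt0 // subnKC ?(ltnW ltCR) //; split=> //.
  move: prodE; rewrite -{1}(subnKC (ltnW ltCR)) => prodE.
  apply: (@addnI (A * q * C)); rewrite prodE; ring.
have [t defC] : exists t, C = R + t by exists (C - R); rewrite subnKC.
have eqt : A * q * t + b * C = A * b.
  by apply: (@addnI (A * q * R)); rewrite -prodE defC; ring.
case: t => [|t] in defC eqt.
  move: eqt; rewrite defC muln0 addn0 add0n mulnC => /eqP.
  by rewrite eqn_pmul2r // => /eqP ->.
have bC_gt0 : 0 < b * C by rewrite muln_gt0 b_gt0.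
have : A * b <= A * q * t.+1.
  by apply: leq_trans (leq_pmulr _ _); rewrite // leq_mul2l leb orbT.
lia.
Qed.

Lemma defect_lt q b d k A C : 0 < b -> q.+1 ^ k <= A -> C < q.+1 ^ k.+1 ->
  A * (q * d + b) = b * C -> d < b.
Proof.
move=> b_gt0 leA ltC eqAC; rewrite ltnNge; apply/negP => lebd.
(* [b <= d] would give [b B <= q d + b]. *)
have : b * C < b * q.+1 ^ k.+1 by rewrite ltn_pmul2l.
rewrite -eqAC ltnNge => /negP; apply.
by rewrite expnS mulnA mulnC leq_mul //; nia.
Qed.

Lemma twice_le q b d A C : b <= q -> 0 < b -> 0 < d ->
  A * (q * d + b) = b * C -> 2 * A <= C.
Proof.
move=> leb b_gt0 d_gt0 eqAC; rewrite -(leq_pmul2l b_gt0) -eqAC.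
have -> : b * (2 * A) = A * (2 * b) by ring.
by rewrite leq_mul2l; apply/orP; right; nia.
Qed.

(** The equation is turned into [D (A q + b) = b^2 B^k], where
    [D = q d + b = B d + e] is coprime to [B] as soon as [e] is.  Then [A] is
    congruent to the repdigit [R] modulo [B^k], too much for [A < R < B^k]. *)
Lemma not_coprime_last q b d e k A C R : b = d + e ->
    R * q + b = b * q.+1 ^ k -> R < q.+1 ^ k -> A < R -> R = C + d ->
    A * (q * d + b) = b * C ->
  ~~ coprime e q.+1.
Proof.
move=> defb eqR ltR ltAR defR eqAC; apply/negP => co_e.
have co_D : coprime (q.+1 ^ k) (q * d + b).
  rewrite coprime_sym coprimeXr // defb addnA -mulSnr mulnC.
  by rewrite /coprime gcdnC gcdnMDl gcdnC.
have eqD : (q * d + b) * (A * q + b) = b * (b * q.+1 ^ k).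
  by rewrite -eqR defR; transitivity (A * (q * d + b) * q + b * (q * d + b));
    [ring | rewrite eqAC; ring].
have dvAq : q.+1 ^ k %| A * q + b.
  by rewrite -(Gauss_dvdr _ co_D) eqD mulnA dvdn_mull.
have : q.+1 ^ k %| (R - A) * q.
  rewrite mulnBl -(subnDr b) dvdn_sub // eqR dvdn_mull //.
rewrite Gauss_dvdl; last by rewrite coprimeXl // coprimeSn.
by move/dvdn_leq; lia.
Qed.

(** Modulo the base, [D = q d + b] is [e], so that the equation reduces to
    [x e = b e].  The quotient of [e (x - b)] by the base given in the proof is
    read off from the full equation. *)
Lemma not_coprime_diff q b d e x A' C' : 0 < e -> e < q.+1 -> b = d + e ->
    (A' * q.+1 + x) * (q * d + b) = b * (C' * q.+1 + e) ->
  (1 < gcdz (x%:Z - b%:Z) q.+1%:Z)%R.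
Proof.
move=> e_gt0 lte defb eqAC.
have gcd_neq1 : gcdz (x%:Z - b%:Z)%R q.+1%:Z != 1%R.
  apply/negP=> co; have {}co : coprimez q.+1%:Z (x%:Z - b%:Z)%R.
    by rewrite coprimez_sym.
  have : (q.+1%:Z %| e%:Z)%Z.
    rewrite -(Gauss_dvdzr _ co); apply/dvdzP.
    (* [q d + b] is written as [B d + e]. *)
    exists (b%:Z * C'%:Z - A'%:Z * (q.+1%:Z * d%:Z + e%:Z) - x%:Z * d%:Z)%R.
    by move/(congr1 Posz): eqAC; rewrite defb; lia.
  by rewrite dvdzE /= => /(dvdn_leq e_gt0); lia.
have : 0 < gcdn `|(x%:Z - b%:Z)%R| q.+1 by rewrite gcdn_gt0 orbT.
move: gcd_neq1; rewrite /gcdz /=; lia.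
Qed.

Theorem theorem2 (B k : nat) (a : k.-tuple nat) (b : nat) (c : k.-tuple nat)
    (hB : 2 <= B) (hk : 1 <= k) (hN : is_N B a b c) (hP : propPstar B a b c) :
  [/\ ((digit a 1)%:R < B%:R / 2%:R :> rat)%R,
      [/\ forall i : nat, 1 <= i <= k - 1 -> digit c i = b,
          digit c k < b
        & 1 < digit c k],
      1 < gcdn (digit c k) B
    & digit a k <> b -> (1 < gcdz ((digit a k)%:Z - b%:Z) B%:Z)%R].
Proof.
case: hN; rewrite all_cat /= => /and3P[diga ltbB digc] a1_neq0.
case: hP; rewrite /propP numeral_cons numeral_rcons size_tuple.
move=> prodE [_ _ bc_neq0] not_const.
case: B hB => // q q_gt0 in diga ltbB digc prodE bc_neq0 *.
case: k hk => // k _ in a c diga digc a1_neq0 prodE bc_neq0 not_const *.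
rewrite /is_digit ltnS in ltbB.
have sza := size_tuple a; have szc := size_tuple c.
have ltC := numeral_lt q.+1 _ isT digc.
rewrite szc in ltC.
have leA : digit a 1 * q.+1 ^ k <= numeral q.+1 a.
  case: (tval a) sza => //= x s [szs]; rewrite numeral_cons szs.
  exact: leq_addr.
have leBA : q.+1 ^ k <= numeral q.+1 a.
  by apply: leq_trans leA; rewrite leq_pmull // lt0n; apply/eqP.
have E_gt0 m : 0 < q.+1 ^ m by rewrite expn_gt0.
have A_gt0 : 0 < numeral q.+1 a := leq_trans (E_gt0 k) leBA.
(* By the product identity, if one of [b], [C] vanishes then so does the other. *)
have [b_gt0 C_gt0] : 0 < b /\ 0 < numeral q.+1 c.
  have := E_gt0 k.+1; move: prodE bc_neq0 A_gt0 q_gt0.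
  move: (_ ^ _) (numeral _ a) (numeral _ c) => E A C; case: b {not_const ltbB}.
    by case: C => [|C]; [lia | nia].
  by move=> b; case: C => [|C]; [nia | lia].
pose rep := nseq k.+1 b.
have digrep : all (is_digit q.+1) rep by rewrite all_nseq /is_digit ltnS ltbB orbT.
have szrep : size rep = k.+1 by rewrite size_nseq.
have eqR : numeral q.+1 rep * q + b = b * q.+1 ^ k.+1 := numeral_repdigit q k.+1 b.
have ltR : numeral q.+1 rep < q.+1 ^ k.+1.
  by rewrite -[X in _ ^ X]szrep; apply: numeral_lt.
case: (two_block_eq _ _ _ _ _ _ ltbB b_gt0 C_gt0 eqR prodE).
  case=> eqCR eqAR; case: not_const.
  have -> : tval a = rep by apply: numeral_inj eqAR; rewrite ?sza.
  have -> : tval c = rep by apply: numeral_inj eqCR; rewrite ?szc.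
  by apply: (all_pred1_constant (x := b)); rewrite all_cat /= all_pred1_nseq eqxx.
case=> d d_gt0 [defR eqAC].
have ltdb := defect_lt _ _ _ _ _ _ b_gt0 leBA ltC eqAC.
have le2A := twice_le _ _ _ _ _ ltbB b_gt0 d_gt0 eqAC.
have defc : tval c = rcons (nseq k b) (b - d).
  apply: (numeral_inj q.+1); rewrite ?size_rcons ?size_nseq //.
    by rewrite all_rcons all_nseq /is_digit !ltnS ltbB orbT; lia.
  apply: (@addIn d); rewrite -defR /rep numeral_rcons.
  rewrite (_ : nseq k.+1 b = rcons (nseq k b) b) ?numeral_rcons.
    by rewrite -addnA subnK // ltnW.
  by rewrite -cats1 -[[:: b]]/(nseq 1 b) -nseqD addn1.
have ck : digit c k.+1 = b - d.
  by rewrite defc -{2}(size_nseq k b) digit_size.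
have defb : b = d + (b - d) by lia.
have ltAR : numeral q.+1 a < numeral q.+1 rep by lia.
have := not_coprime_last _ _ _ _ _ _ _ _ defb eqR ltR ltAR defR eqAC.
rewrite ck => gcd_neq1; have gcd_gt1 : 1 < gcdn (b - d) q.+1.
  have : 0 < gcdn (b - d) q.+1 by rewrite gcdn_gt0 orbT.
  by move: gcd_neq1; rewrite /coprime; lia.
split=> //.
- rewrite Num.Theory.ltr_pdivlMr ?Num.Theory.ltr0n // -GRing.natrM Num.Theory.ltr_nat.
  rewrite -(ltn_pmul2r (E_gt0 k)) -expnS.
  by apply: leq_ltn_trans ltC; apply: leq_trans le2A; lia.
- split; [|lia|].
    case=> [|i] //; rewrite subn1 /= => ltik.
    by rewrite defc /digit /= nth_rcons size_nseq ltik nth_nseq ltik.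
  apply: leq_trans gcd_gt1 (dvdn_leq _ (dvdn_gcdl _ _)); lia.
- move=> _; case/lastP: (tval a) sza eqAC => // s x; rewrite size_rcons => -[szs].
  rewrite -{2}szs digit_size defc !numeral_rcons => eqAC.
  by apply: not_coprime_diff eqAC; lia.
Qed.
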